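(* For any basic continuous map $f\colon\mathcal{S}\to\mathcal{T}$ between b0-spaces, its basic image $f_{\rightarrow}\colon\mathcal{B}d(\mathcal{S})\to\mathcal{B}d(\mathcal{T})$ has a right adjoint.
   Context: A closure system on a set $X$ is a family of subsets of $X$ containing $X$ and closed under arbitrary intersections; ordered by inclusion it is a complete lattice whose meets are intersections and whose joins $\vee$ are the least members containing the union. A basic zero-dimensional space (b0-space) is a triple $\mathcal{S}=(X,\mathcal{C},\mathcal{B}d)$ where $X$ is a set, $\mathcal{B}d$ is a closure system on $X$ that is distributive as a lattice, and $\mathcal{C}\subseteq\mathcal{B}d$ is such that every $C\in\mathcal{C}$ has a complement $\neg C$ in the lattice $\mathcal{B}d$, and every $M\in\mathcal{B}d$ is of the form $M=\bigcap_{i\in J}(C_i^1\vee\neg D_i^1\vee\dots\vee C_i^{n_i}\vee\neg D_i^{n_i})$ with all $C_i^k,D_i^k\in\mathcal{C}$ (finite joins in $\mathcal{B}d$, the empty join being allowed). Write $|\mathcal{S}|=X$, $\mathcal{C}(\mathcal{S})=\mathcal{C}$, $\mathcal{B}d(\mathcal{S})=\mathcal{B}d$; the bottom element of $\mathcal{B}d$ is denoted $\mathsf{O}$ (same symbol for every b0-space). A basic continuous map $f\colon\mathcal{S}\to\mathcal{T}$ between b0-spaces is a map $f\colon|\mathcal{S}|\to|\mathcal{T}|$ such that: (BC1) $f^{-1}[\mathsf{O}]=\mathsf{O}$; (BC2) there is a map $f_{\leftarrow}^{\mathfrak{c}}\colon\mathcal{C}(\mathcal{T})\to\mathcal{C}(\mathcal{S})$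 such that $f[B]\subseteq C$ iff $B\subseteq f_{\leftarrow}^{\mathfrak{c}}[C]$ for all $B\in\mathcal{C}(\mathcal{S})$, $C\in\mathcal{C}(\mathcal{T})$ (this map is then unique); (BC3) $\neg f_{\leftarrow}^{\mathfrak{c}}[C]\subseteq f^{-1}[\neg C]$ for all $C\in\mathcal{C}(\mathcal{T})$; (BC4) $\bigvee_{i=1}^n(f_{\leftarrow}^{\mathfrak{c}}[C_i]\vee\neg f_{\leftarrow}^{\mathfrak{c}}[D_i])\subseteq f^{-1}[\bigvee_{i=1}^n(C_i\vee\neg D_i)]$ for all $n$ and all $C_i,D_i\in\mathcal{C}(\mathcal{T})$. The basic image of $f$ is the map $f_{\rightarrow}\colon\mathcal{B}d(\mathcal{S})\to\mathcal{B}d(\mathcal{T})$ given by $f_{\rightarrow}[M]=\bigcap\{S\in\mathcal{B}d(\mathcal{T})\mid f[M]\subseteq S\}$. *)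

(* Defs.v *)
From mathcomp Require Import all_boot.
From mathcomp Require Import boolp classical_sets.

Set Implicit Arguments.
Unset Strict Implicit.
Unset Printing Implicit Defensive.

Local Open Scope classical_set_scope.

Section ClosureSystems.
Variable X : Type.
Implicit Types (Bd F : set (set X)) (A B : set X).

Definition closure_system Bd : Prop :=
  Bd setT /\ forall F, F `<=` Bd -> Bd (\bigcap_(A in F) A).

Definition bot Bd : set X := smallest Bd set0.

Definition join Bd A B : set X := smallest Bd (A `|` B).

Definition joins Bd n (A : 'I_n -> set X) : set X :=
  smallest Bd (\bigcup_(k in [set: 'I_n]) A k).

Definition distributive_lattice Bd : Prop :=
  forall A B C, Bd A -> Bd B -> Bd C ->
    A `&` join Bd B C = join Bd (A `&` B) (A `&` C).

Definition is_complement Bd A B : Prop :=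
  [/\ Bd B, A `&` B = bot Bd & join Bd A B = setT].

(* The complement of A in Bd when there is one (it is then unique if Bd is
   distributive), and the junk value set0 otherwise. *)
Definition neg Bd A : set X := xget set0 [set B | is_complement Bd A B].

(* The members C_1 \/ ~D_1 \/ ... \/ C_n \/ ~D_n of Bd, with all C_k and D_k
   in Cl; the case n = 0 is the bottom element. *)
Definition clause Bd n (C D : 'I_n -> set X) : set X :=
  joins Bd (fun k => join Bd (C k) (neg Bd (D k))).

Definition clauses (Cl Bd : set (set X)) : set (set X) :=
  [set A | exists n (C D : 'I_n -> set X),
     [/\ forall k, Cl (C k), forall k, Cl (D k) & A = clause Bd C D]].

End ClosureSystems.

Record b0space := B0Space {
  carrier :> Type;
  Cl : set (set carrier);
  Bd : set (set carrier);
  Bd_closure_system : closure_system Bd;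
  Bd_distributive : distributive_lattice Bd;
  Cl_sub_Bd : Cl `<=` Bd;
  Cl_complemented : forall C, Cl C -> exists D, is_complement Bd C D;
  Bd_clauses : forall M, Bd M ->
    exists2 F, F `<=` clauses Cl Bd & M = \bigcap_(A in F) A
}.

Arguments Cl : clear implicits.
Arguments Bd : clear implicits.

Section BasicContinuous.
Variables S T : b0space.

(* g stands for a map Cl T -> Cl S: its values outside Cl T are irrelevant, and
   its values on Cl T are determined by f (second condition). *)
Definition basic_continuous (f : S -> T) : Prop :=
  f @^-1` (bot (Bd T)) = bot (Bd S) /\
  exists g : set T -> set S,
    [/\ forall C, Cl T C -> Cl S (g C),
        forall B C, Cl S B -> Cl T C -> (f @` B `<=` C <-> B `<=` g C),
        forall C, Cl T C -> neg (Bd S) (g C) `<=` f @^-1` (neg (Bd T) C)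
      & forall n (C D : 'I_n -> set T),
          (forall k, Cl T (C k)) -> (forall k, Cl T (D k)) ->
          clause (Bd S) (g \o C) (g \o D) `<=` f @^-1` (clause (Bd T) C D)].

End BasicContinuous.

Definition Bd_elt (S : b0space) : Type := {M : set S | Bd S M}.

Definition Bd_val (S : b0space) (M : Bd_elt S) : set S := proj1_sig M.
Coercion Bd_val : Bd_elt >-> set.

Lemma Bd_smallest (S : b0space) (A : set S) : Bd S (smallest (Bd S) A).
Proof. by apply: (Bd_closure_system S).2 => M []. Qed.

Definition basic_image (S T : b0space) (f : S -> T) (M : Bd_elt S) : Bd_elt T :=
  exist _ (smallest (Bd T) (f @` M)) (Bd_smallest (f @` M)).

Definition right_adjoint (S T : b0space)
    (h : Bd_elt S -> Bd_elt T) (g : Bd_elt T -> Bd_elt S) : Prop :=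
  forall (M : Bd_elt S) (N : Bd_elt T), h M `<=` N <-> M `<=` g N.

(* Main.v *)
Require Import Defs.
From mathcomp Require Import all_boot.
From mathcomp Require Import boolp classical_sets.

(** Since [N] is a member of [Bd T], the inclusion [basic_image f M `<=` N] just
    says [f @` M `<=` N], so a right adjoint exists as soon as every [N] has a
    largest [M] in [Bd S] mapped into it by [f].  Every [N] is an intersection
    of clauses, so a clause [K] built from families [C], [D] is the case that
    matters; its largest [M] is the clause [K'] built from [g \o C], [g \o D],
    where [g] is the map of (BC2).

    That [f] maps [K'] into [K] is (BC4).  Conversely let [f @` M `<=` K].  A
    clause is complemented, and its complement is the intersection of all the
    [D k] and [neg (C k)] ([is_complement_clause]).  By (BC2) and (BC3), [f] maps
    the complement of [K'] into that of [K], so it maps the part of [M] outside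
    [K'] into the bottom element; by (BC1) that part is bottom, whence
    [M `<=` K'] by distributivity ([sub_complemented]). *)

Set Implicit Arguments.
Unset Strict Implicit.
Unset Printing Implicit Defensive.

Local Open Scope classical_set_scope.

Section Complements.
Variables (X : Type) (Bd : set (set X)).
Hypotheses (Bdcl : closure_system Bd) (Bddist : distributive_lattice Bd).
Implicit Types A B M V : set X.

Lemma closure_system_smallest A : Bd (smallest Bd A).
Proof. by apply: Bdcl.2 => M []. Qed.

Lemma closure_system_bigcap (I : Type) (P : set I) (F : I -> set X) :
  (forall i, P i -> Bd (F i)) -> Bd (\bigcap_(i in P) F i).
Proof.
move=> BdF; rewrite -(bigcap_image P F id).
by apply: Bdcl.2 => _ [i Pi <-]; exact: BdF.
Qed.

Lemma closure_systemI A B : Bd A -> Bd B -> Bd (A `&` B).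
Proof.
move=> BdA BdB; rewrite -bigcap2E; apply: closure_system_bigcap.
by move=> [|[|i]] _ //=; exact: Bdcl.1.
Qed.

Lemma bot_sub V : Bd V -> bot Bd `<=` V.
Proof. by move=> BdV; apply: smallest_sub. Qed.

Lemma join_sub A B V : Bd V -> A `<=` V -> B `<=` V -> join Bd A B `<=` V.
Proof. by move=> BdV AV BV; apply: smallest_sub => // x [/AV|/BV]. Qed.

Lemma sub_joinl A B : A `<=` join Bd A B.
Proof. by move=> x Ax; apply: sub_gen_smallest; left. Qed.

Lemma sub_joinr A B : B `<=` join Bd A B.
Proof. by move=> x Bx; apply: sub_gen_smallest; right. Qed.

Lemma is_complement_sym A B : Bd A -> is_complement Bd A B ->
  is_complement Bd B A.
Proof.
by move=> BdA [BdB AB0 ABT]; split; rewrite // /join (setIC, setUC).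
Qed.

Lemma is_complement_neg A : (exists B, is_complement Bd A B) ->
  is_complement Bd A (neg Bd A).
Proof. by case=> B AB; rewrite /neg; case: xgetP => [_ -> //|/(_ B)]. Qed.

Lemma sub_complemented A B M : Bd A -> Bd M -> is_complement Bd A B ->
  M `&` B `<=` bot Bd -> M `<=` A.
Proof.
move=> BdA BdM [BdB _ ABT] MB0.
rewrite -[M]setIT -ABT Bddist //; apply: join_sub => //.
by apply: subset_trans MB0 _; exact: bot_sub.
Qed.

Lemma is_complement_join A1 B1 A2 B2 : Bd A1 -> Bd A2 ->
  is_complement Bd A1 B1 -> is_complement Bd A2 B2 ->
  is_complement Bd (join Bd A1 A2) (B1 `&` B2).
Proof.
move=> BdA1 BdA2 [BdB1 AB1 ABT1] [BdB2 AB2 ABT2].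
have BdB : Bd (B1 `&` B2) by exact: closure_systemI.
have Bdbot : Bd (bot Bd) by exact: closure_system_smallest.
split=> //.
  apply/seteqP; split; last first.
    apply: bot_sub; apply: closure_systemI => //.
    exact: closure_system_smallest.
  rewrite setIC Bddist //; apply: join_sub => // x [[B1x B2x] Ax].
    by rewrite -AB1; split.
  by rewrite -AB2; split.
set V := join Bd _ _; have BdV : Bd V by exact: closure_system_smallest.
have A1V : A1 `<=` V by apply: subset_trans (@sub_joinl _ _); exact: sub_joinl.
have A2V : A2 `<=` V by apply: subset_trans (@sub_joinl _ _); exact: sub_joinr.
(* B1 = (B1 /\ A2) \/ (B1 /\ B2), so V contains both A1 and its complement. *)
have B1V : B1 `<=` V.
  rewrite -[B1]setIT -ABT2 Bddist //; apply: join_sub => //.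
    by apply: subset_trans A2V; exact: subIsetr.
  exact: sub_joinr.
by apply/seteqP; split=> // x _; apply: (join_sub BdV A1V B1V); rewrite ABT1.
Qed.

Lemma join_smallestr A U :
  join Bd A (smallest Bd U) = smallest Bd (A `|` U).
Proof.
apply/seteqP; split.
  apply: join_sub; first exact: closure_system_smallest.
    by move=> x Ax; apply: sub_gen_smallest; left.
  by apply: smallest_sub; [exact: closure_system_smallest|
    by move=> x Ux; apply: sub_gen_smallest; right].
apply: smallest_sub; first exact: closure_system_smallest.
move=> x [Ax|Ux]; first exact: sub_joinl.
by apply: sub_joinr; exact: sub_gen_smallest.
Qed.

(** Distributivity only speaks of finite joins, so the De Morgan law for a
    finite family has to be obtained by induction on an enumeration of it. *)
Lemma is_complement_smallest_seq (I : eqType) (s : seq I) (A B : I -> set X) :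
  (forall i, Bd (A i)) -> (forall i, is_complement Bd (A i) (B i)) ->
  is_complement Bd (smallest Bd (\bigcup_(i in [set` s]) A i))
                   (\bigcap_(i in [set` s]) B i).
Proof.
move=> BdA AB; elim: s => [|i s IHs].
  rewrite set_nil bigcup_set0 bigcap_set0; split; first exact: Bdcl.1.
  - by rewrite setIT.
  - by apply/seteqP; split=> // x _; exact: sub_joinr.
have -> : [set` i :: s] = i |` [set` s].
  by apply/seteqP; split=> j /=; rewrite in_cons => /predU1P.
rewrite bigcup_setU1 bigcap_setU1 -join_smallestr.
by apply: is_complement_join => //; exact: closure_system_smallest.
Qed.

Lemma is_complement_joins n (A B : 'I_n -> set X) :
  (forall k, Bd (A k)) -> (forall k, is_complement Bd (A k) (B k)) ->
  is_complement Bd (joins Bd A) (\bigcap_k B k).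
Proof.
move=> BdA AB; have := is_complement_smallest_seq (enum 'I_n) BdA AB.
have -> // : [set` enum 'I_n] = [set: 'I_n].
by apply/seteqP; split=> // k _ /=; rewrite mem_enum.
Qed.

End Complements.

Section Clauses.
Variable S : b0space.

Lemma is_complement_negCl C : Cl S C -> is_complement (Bd S) C (neg (Bd S) C).
Proof. by move=> /Cl_complemented; exact: is_complement_neg. Qed.

Lemma is_complement_clause n (C D : 'I_n -> set S) :
  (forall k, Cl S (C k)) -> (forall k, Cl S (D k)) ->
  is_complement (Bd S) (clause (Bd S) C D)
    (\bigcap_k (neg (Bd S) (C k) `&` D k)).
Proof.
move=> ClC ClD; have Scl := Bd_closure_system S.
apply: (is_complement_joins Scl (@Bd_distributive S)) => k.
  exact: closure_system_smallest.
have BdC := Cl_sub_Bd (ClC k); have BdD := Cl_sub_Bd (ClD k).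
have cC := is_complement_negCl (ClC k); have cD := is_complement_negCl (ClD k).
apply: (is_complement_join Scl (@Bd_distributive S)) => //; first by case: cD.
exact: is_complement_sym.
Qed.

End Clauses.

Lemma basic_image_sub (S T : b0space) (f : S -> T) (M : Bd_elt S) (N : set T) :
  Bd T N -> basic_image f M `<=` N <-> f @` M `<=` N.
Proof.
move=> BdN; split=> [hMN|fMN]; last exact: smallest_sub.
by apply: subset_trans hMN; exact: sub_gen_smallest.
Qed.

(** The converse of (BC4): [M] is compared with the clause by meeting it with the
    complement of the clause, because that complement is an intersection of sets
    [g (D k)] and [neg (g (C k))], on each of which [f] is under control. *)
Lemma sub_clause (S T : b0space) (f : S -> T) (g : set T -> set S)
    n (C D : 'I_n -> set T) (M : set S) :
  f @^-1` (bot (Bd T)) `<=` bot (Bd S) ->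
  (forall C, Cl T C -> Cl S (g C)) ->
  (forall C, Cl T C -> f @` g C `<=` C) ->
  (forall C, Cl T C -> neg (Bd S) (g C) `<=` f @^-1` (neg (Bd T) C)) ->
  (forall k, Cl T (C k)) -> (forall k, Cl T (D k)) ->
  Bd S M -> f @` M `<=` clause (Bd T) C D ->
  M `<=` clause (Bd S) (g \o C) (g \o D).
Proof.
move=> f0 gCl fg fneg ClC ClD BdM fM.
have cS := @is_complement_clause S n (g \o C) (g \o D)
  (fun k => gCl _ (ClC k)) (fun k => gCl _ (ClD k)).
apply: (sub_complemented (@Bd_distributive S) _ BdM cS).
  by apply: closure_system_smallest; exact: Bd_closure_system.
move=> x [Mx cx]; apply: f0; rewrite /preimage /=.
have [_ <- _] := is_complement_clause ClC ClD.
split=> [|k _]; first by apply: fM; exists x.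
have [ngCx gDx] := cx k Logic.I; split; first exact: fneg.
by apply: fg => //; exists x.
Qed.

Theorem proposition4p2 (S T : b0space) (f : S -> T) (hf : basic_continuous f) :
  exists g : Bd_elt T -> Bd_elt S, right_adjoint (basic_image f) g.
Proof.
have [f0 [g [gCl fgP fneg fclause]]] := hf.
have fg C : Cl T C -> f @` g C `<=` C by move=> ClC; apply/fgP => //; exact: gCl.
(* Taking all the clauses above N spares choosing a representation of N. *)
pose G (N : set T) : set (set S) := [set K | exists n (C D : 'I_n -> set T),
  [/\ forall k, Cl T (C k), forall k, Cl T (D k), N `<=` clause (Bd T) C D &
      K = clause (Bd S) (g \o C) (g \o D)]].
have BdG N : Bd S (\bigcap_(K in G N) K).
  apply: (Bd_closure_system S).2 => _ [n [C [D [_ _ _ ->]]]].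
  by apply: closure_system_smallest; exact: Bd_closure_system.
exists (fun N => exist _ _ (BdG N)) => M N.
have BdN : Bd T N by case: N.
rewrite basic_image_sub //; split=> [fMN | MG].
  move=> x Mx _ [n [C [D [ClC ClD NK ->]]]].
  apply: (sub_clause _ gCl fg fneg ClC ClD (proj2_sig M)) Mx.
    by rewrite f0.
  exact: subset_trans fMN NK.
have [F Fcl NE] := Bd_clauses BdN.
move=> _ [x Mx <-]; rewrite NE => A FA.
have [n [C [D [ClC ClD AE]]]] := Fcl _ FA.
rewrite AE; apply: fclause => //; apply: (MG x Mx).
by exists n, C, D; split=> //; rewrite -AE NE => y; exact.
Qed.
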